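(* Let $f:\mathbb{R}^{n+1}\to\mathbb{R}$ be $\mu$-strongly convex and $L$-smooth with minimizer $x^\star$ and minimum value $f^\star$, and let $\{x_k\}$ be YAND iterates $x_{k+1}=x_k+\alpha_kd_k$ whose directions are T-bounded, i.e. there is $T<\infty$ with $T_k=\|\tau_k\|\le T$ for all $k$. Then under Armijo backtracking with $\sigma\in(0,1)$ and $\beta\in[1/2,1)$ the following hold: (i) (Function values) $f(x_{k+1})-f^\star\le(1-\rho_{\mathrm{Armijo}})(f(x_k)-f^\star)$, where $\rho_{\mathrm{Armijo}}:=\frac{2\sigma(1-\sigma)}{1+T^2}\cdot\frac{\mu}{L}\in(0,1/2)$. Consequently $f(x_k)-f^\star\le(1-\rho_{\mathrm{Armijo}})^k(f(x_0)-f^\star)$ for all $k\ge0$, i.e. $\{f(x_k)\}$ converges Q-linearly to $f^\star$. (ii) (Iterates) $\|x_k-x^\star\|^2\le\frac2\mu(f(x_k)-f^\star)\le\frac2\mu(f(x_0)-f^\star)(1-\rho_{\mathrm{Armijo}})^k$ for all $k\ge0$; hence $\{x_k\}$ converges R-linearly to $x^\star$. (iii) (Gradients) $\|\nabla f(x_k)\|^2\le2L(f(x_k)-f^\star)\le2L(f(x_0)-f^\star)(1-\rho_{\mathrm{Armijo}})^k$ for all $k\ge0$; thus $\{\nabla f(x_k)\}$ converges R-linearly to $0$.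
   Context: $L$-smooth means $\|\nabla f(x)-\nabla f(y)\|\le L\|x-y\|$ for all $x,y$. The function $f$ is sufficiently smooth for the affine normals below to be defined. YAND direction. At $x_k$ with $\nabla f(x_k)\ne0$ put $e_{n+1}=\nabla f(x_k)/\|\nabla f(x_k)\|$ and let $e_1,\dots,e_n$ be an orthonormal basis of $\nabla f(x_k)^\perp$ (normal-aligned frame). With $f_{ij}=D^2f(x_k)[e_i,e_j]$, $f_{n+1,i}=D^2f(x_k)[e_{n+1},e_i]$, $f_{pqi}=D^3f(x_k)[e_p,e_q,e_i]$ ($i,j,p,q\le n$) and $(f^{ij})$ the inverse of $(f_{ij})_{i,j\le n}$, the affine normal direction is, up to a nonzero scalar, $d_{\mathrm{AN}}(x_k)\propto\sum_i\big(\sum_jf^{ij}(-\frac1{n+2}\|\nabla f(x_k)\|\sum_{p,q}f^{pq}f_{pqj}+f_{n+1,j})\big)e_i-e_{n+1}$. The direction $d_k$ is $d_{\mathrm{AN}}(x_k)$ if $\langle\nabla f(x_k),d_{\mathrm{AN}}(x_k)\rangle<0$, $-d_{\mathrm{AN}}(x_k)$ if this inner product is $>0$, and $-\nabla f(x_k)/\|\nabla f(x_k)\|$ otherwise; it is scaled so that $d_k=\sum_{i=1}^n(\tau_k)_ie_i-e_{n+1}$ with $\tau_k\in\mathbb{R}^n$, and $T_k:=\|\tau_k\|$. The iteration stops when $\nabla f(x_k)=0$; $k$ ranges over the generated iterates. Armijo backtracking: given $\sigma,\beta\in(0,1)$ and an initial trial step $\alpha_0>0$ (e.g. $\alpha_0=1$),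 $\alpha_k=\beta^m\alpha_0$ for the smallest integer $m\ge0$ with $f(x_k+\beta^m\alpha_0d_k)\le f(x_k)+\sigma\beta^m\alpha_0\langle\nabla f(x_k),d_k\rangle$.
   Formalization: The inequalities with the rate ρ_Armijo are stated only when α_0 ≥ (1-σ)‖∇f(x_j)‖/(L(1+T²)) at the iterates concerned (they fail otherwise), and ρ_Armijo<1/2 becomes ≤1/2, strict unless T=0, σ=1/2 and μ=L. *)

(* Defs.v *)
From HB Require Import structures.
From mathcomp Require Import all_boot all_order all_algebra.
From mathcomp Require Import all_classical all_reals all_analysis.

Set Implicit Arguments.
Unset Strict Implicit.
Unset Printing Implicit Defensive.

Import Order.TTheory GRing.Theory Num.Theory.
Import numFieldNormedType.Exports.

Local Open Scope classical_set_scope.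
Local Open Scope ring_scope.

(* The norm [`|u|] of MathComp-Analysis on ['rV_m] is the sup norm, so the
   Euclidean structure is set up here. The two norms induce the same topology,
   hence the same notions of continuity and differentiability. *)
Definition dot (R : realType) (m : nat) (u v : 'rV[R]_m) : R :=
  \sum_(i < m) u 0 i * v 0 i.

Definition enorm (R : realType) (m : nat) (u : 'rV[R]_m) : R :=
  Num.sqrt (dot u u).

Definition grad (R : realType) (m : nat) (f : 'rV[R]_m.+1 -> R)
    (x : 'rV[R]_m.+1) : 'rV[R]_m.+1 :=
  \row_(i < m.+1) 'D_(delta_mx 0 i) f x.

(* In finite dimension, continuity of all iterated directional derivatives of
   order at most [r] is the usual class C^r. *)
Fixpoint class_C (R : realType) (m : nat) (r : nat)
    (f : 'rV[R]_m.+1 -> R) : Prop :=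
  if r is r'.+1 then
    (forall x, differentiable f x) /\
    (forall v, class_C r' (fun x => 'D_v f x))
  else continuous f.

Definition D2 (R : realType) (m : nat) (f : 'rV[R]_m.+1 -> R)
    (x u v : 'rV[R]_m.+1) : R :=
  'D_u (fun y => 'D_v f y) x.

Definition D3 (R : realType) (m : nat) (f : 'rV[R]_m.+1 -> R)
    (x u v w : 'rV[R]_m.+1) : R :=
  'D_u (fun y => 'D_v (fun z => 'D_w f z) y) x.

Definition strongly_convex (R : realType) (m : nat) (mu : R)
    (f : 'rV[R]_m -> R) : Prop :=
  0 < mu /\
  forall (x y : 'rV[R]_m) (t : R), 0 <= t -> t <= 1 ->
    f (t *: x + (1 - t) *: y) <=
      t * f x + (1 - t) * f y
      - mu / 2 * t * (1 - t) * enorm (x - y) ^+ 2.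

Definition L_smooth (R : realType) (m : nat) (L : R)
    (f : 'rV[R]_m.+1 -> R) : Prop :=
  (forall x, differentiable f x) /\
  forall x y, enorm (grad f x - grad f y) <= L * enorm (x - y).

Section YAND.
Context (R : realType) (n : nat) (f : 'rV[R]_n.+1 -> R).
Implicit Types (x d v : 'rV[R]_n.+1) (e : 'I_n -> 'rV[R]_n.+1).

(* e_{n+1} in the normal-aligned frame. *)
Definition unit_grad x : 'rV[R]_n.+1 := (enorm (grad f x))^-1 *: grad f x.

(* [n] orthonormal vectors of the [n]-dimensional space orthogonal to the
   gradient: automatically a basis of it. *)
Definition normal_aligned_frame x e : Prop :=
  (forall i j, dot (e i) (e j) = (i == j)%:R) /\
  (forall i, dot (grad f x) (e i) = 0).

(* (f_ij), for i, j <= n. *)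
Definition tangent_hessian x e : 'M[R]_n :=
  \matrix_(i < n, j < n) D2 f x (e i) (e j).

(* Coefficients of the affine normal on e_1, ..., e_n when its coefficient on
   e_{n+1} is -1. *)
Definition affine_normal_coef x e : 'cV[R]_n :=
  let H := invmx (tangent_hessian x e) in
  H *m \col_(j < n)
    (- (n.+2%:R)^-1 * enorm (grad f x)
       * (\sum_(p < n) \sum_(q < n) H p q * D3 f x (e p) (e q) (e j))
     + D2 f x (unit_grad x) (e j)).

(* The affine normal is only defined up to a nonzero scalar. *)
Definition is_affine_normal x e v : Prop :=
  exists2 c : R, c != 0 &
    v = c *: (\sum_(i < n) affine_normal_coef x e i 0 *: e i - unit_grad x).

Definition descent_orientation x v : 'rV[R]_n.+1 :=
  if dot (grad f x) v < 0 then v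
  else if 0 < dot (grad f x) v then - v
  else - unit_grad x.

Definition yand_direction x e (tau : 'rV[R]_n) d : Prop :=
  (exists v (s : R), [/\ is_affine_normal x e v, 0 < s
                       & d = s *: descent_orientation x v]) /\
  d = \sum_(i < n) tau 0 i *: e i - unit_grad x.

Definition armijo_ok (sigma : R) x d (a : R) : bool :=
  f (x + a *: d) <= f x + sigma * a * dot (grad f x) d.

Definition armijo_backtracking (sigma beta alpha0 : R) x d (alpha : R) : Prop :=
  exists m : nat,
    [/\ alpha = beta ^+ m * alpha0,
        armijo_ok sigma x d (beta ^+ m * alpha0)
      & forall j : nat, (j < m)%N ->
          ~~ armijo_ok sigma x d (beta ^+ j * alpha0)].

(* Sequences are indexed by all of [nat], but the iteration stops at the first
   zero of the gradient: the entries after it are not iterates. *)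
Definition generated (x : nat -> 'rV[R]_n.+1) (k : nat) : Prop :=
  forall j : nat, (j < k)%N -> grad f (x j) != 0.

Definition yand_armijo_run (sigma beta alpha0 : R)
    (x : nat -> 'rV[R]_n.+1) (e : nat -> 'I_n -> 'rV[R]_n.+1)
    (tau : nat -> 'rV[R]_n) (d : nat -> 'rV[R]_n.+1) (alpha : nat -> R) : Prop :=
  forall k : nat, generated x k.+1 ->
    [/\ normal_aligned_frame (x k) (e k),
        yand_direction (x k) (e k) (tau k) (d k),
        armijo_backtracking sigma beta alpha0 (x k) (d k) (alpha k)
      & x k.+1 = x k + alpha k *: d k].

Definition T_bounded (x : nat -> 'rV[R]_n.+1) (tau : nat -> 'rV[R]_n)
    (T : R) : Prop :=
  forall k : nat, generated x k.+1 -> enorm (tau k) <= T.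

(* Since [d] is not scaled by the length of the gradient, backtracking from
   [alpha0] can only yield steps of the length needed for the rate
   [rho_Armijo] below when [alpha0] itself has that length. Without this, the
   rate fails: for f(x) = |x|^2 / 2 one has d = - x / |x| and T = 0, and for
   alpha0 = 1, sigma = 1/2, |x| = 100 the full step is accepted and f - f^*
   goes from 5000 to 4900.5, whereas the rate would be 1/2. *)
Definition trial_step_adequate (L sigma T alpha0 : R) x : Prop :=
  (1 - sigma) * enorm (grad f x) / (L * (1 + T ^+ 2)) <= alpha0.

End YAND.

(* Both notions are stated for the sequence of distances to the limit. *)
Definition Q_linear (R : realType) (err : nat -> R) : Prop :=
  err @ \oo --> (0 : R) /\
  exists r : R, [/\ 0 < r, r < 1
                  & \forall k \near \oo, err k.+1 <= r * err k].

Definition R_linear (R : realType) (err : nat -> R) : Prop :=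
  exists eps : nat -> R,
    [/\ forall k, 0 <= eps k, Q_linear eps & forall k, err k <= eps k].

Definition rho_Armijo (R : realType) (mu L sigma T : R) : R :=
  2 * sigma * (1 - sigma) / (1 + T ^+ 2) * (mu / L).

(* Main.v *)
(* In the normal-aligned frame the slope of [f] along [d_k] is [-|g_k|] and
   [|d_k|^2 = 1 + T_k^2 <= D := 1 + T^2], so by the descent lemma every step
   [a <= 2 (1 - sigma) |g_k| / (L D)] passes the Armijo test; as [beta >= 1/2],
   the accepted step is [alpha0] or at least [(1 - sigma) |g_k| / (L D)]. The
   decrease [sigma alpha_k |g_k|] is then a multiple of [|g_k|^2], which the
   Polyak-Lojasiewicz inequality bounds below by [2 mu (f x_k - f xstar)].
   When [alpha0] is small compared with [|g_k|], the argument still gives a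
   uniform contraction, with a worse factor: [f x_k] decreases, so [|g_k|]
   stays bounded and [alpha0] is at least a fixed multiple of it. This yields
   the Q- and R-linear convergence without the adequacy of [alpha0]. *)
Require Import Defs.
From HB Require Import structures.
From mathcomp Require Import all_boot all_order all_algebra.
From mathcomp Require Import all_classical all_reals all_analysis.
From mathcomp Require Import ring lra.

Import Order.TTheory GRing.Theory Num.Theory.
Import numFieldNormedType.Exports.

Local Open Scope classical_set_scope.
Local Open Scope ring_scope.

Set Implicit Arguments.
Unset Strict Implicit.

(** * Euclidean inner product and norm *)

Lemma dotC (R : realType) m (u v : 'rV[R]_m) : dot u v = dot v u.
Proof. by apply: eq_bigr => i _; rewrite mulrC. Qed.

Lemma dotDr (R : realType) m (u v w : 'rV[R]_m) :
  dot u (v + w) = dot u v + dot u w.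
Proof.
by rewrite /dot -big_split /=; apply: eq_bigr => i _; rewrite mxE mulrDr.
Qed.

Lemma dotDl (R : realType) m (u v w : 'rV[R]_m) :
  dot (u + v) w = dot u w + dot v w.
Proof. by rewrite dotC dotDr !(dotC w). Qed.

Lemma dotZr (R : realType) m a (u v : 'rV[R]_m) : dot u (a *: v) = a * dot u v.
Proof. by rewrite /dot mulr_sumr; apply: eq_bigr => i _; rewrite mxE mulrCA. Qed.

Lemma dotZl (R : realType) m a (u v : 'rV[R]_m) : dot (a *: u) v = a * dot u v.
Proof. by rewrite dotC dotZr dotC. Qed.

Lemma dotNr (R : realType) m (u v : 'rV[R]_m) : dot u (- v) = - dot u v.
Proof. by rewrite -scaleN1r dotZr mulN1r. Qed.

Lemma dotNl (R : realType) m (u v : 'rV[R]_m) : dot (- u) v = - dot u v.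
Proof. by rewrite dotC dotNr dotC. Qed.

Lemma dot_sumr (R : realType) m k (u : 'rV[R]_m) (F : 'I_k -> 'rV[R]_m) :
  dot u (\sum_(i < k) F i) = \sum_(i < k) dot u (F i).
Proof.
rewrite /dot exchange_big /=; apply: eq_bigr => i _.
by rewrite summxE mulr_sumr.
Qed.

Lemma dot_suml (R : realType) m k (u : 'rV[R]_m) (F : 'I_k -> 'rV[R]_m) :
  dot (\sum_(i < k) F i) u = \sum_(i < k) dot (F i) u.
Proof. by rewrite dotC dot_sumr; apply: eq_bigr => i _; rewrite dotC. Qed.

Lemma dot_ge0 (R : realType) m (u : 'rV[R]_m) : 0 <= dot u u.
Proof. by apply: sumr_ge0 => i _; rewrite -expr2 sqr_ge0. Qed.

Lemma dot_eq0 (R : realType) m (u : 'rV[R]_m) : (dot u u == 0) = (u == 0).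
Proof.
apply/eqP/eqP => [u0|->]; last by rewrite /dot big1 // => i _; rewrite mxE mul0r.
apply/rowP => i; rewrite mxE; apply/eqP; rewrite -sqrf_eq0 expr2; apply/eqP.
by apply: (psumr_eq0P _ u0) => // j _; rewrite -expr2 sqr_ge0.
Qed.

Lemma sqr_enorm (R : realType) m (u : 'rV[R]_m) : enorm u ^+ 2 = dot u u.
Proof. by rewrite sqr_sqrtr // dot_ge0. Qed.

Lemma enorm_ge0 (R : realType) m (u : 'rV[R]_m) : 0 <= enorm u.
Proof. exact: sqrtr_ge0. Qed.

Lemma enorm_eq0 (R : realType) m (u : 'rV[R]_m) : (enorm u == 0) = (u == 0).
Proof. by rewrite -sqrf_eq0 sqr_enorm dot_eq0. Qed.

Lemma enormZ (R : realType) m a (u : 'rV[R]_m) : enorm (a *: u) = `|a| * enorm u.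
Proof.
by rewrite /enorm dotZl dotZr mulrA -expr2 sqrtrM ?sqr_ge0 // sqrtr_sqr.
Qed.

(** The square of [dot v v *: u - dot u v *: v] is nonnegative and equals [dot v v] times the gap in
    the squared inequality. *)
Lemma cauchy_schwarz (R : realType) m (u v : 'rV[R]_m) :
  `|dot u v| <= enorm u * enorm v.
Proof.
have [->|v0] := eqVneq v 0.
  by rewrite -(scale0r 0) dotZr mul0r normr0 mulr_ge0 ?enorm_ge0.
have vv0 : 0 < dot v v by rewrite lt_neqAle eq_sym dot_eq0 v0 dot_ge0.
rewrite -ler_sqr ?nnegrE ?mulr_ge0 ?enorm_ge0 //.
rewrite exprMn !sqr_enorm real_normK ?num_real //.
have := dot_ge0 (dot v v *: u - dot u v *: v).
rewrite !(dotDl, dotDr, dotNl, dotNr, dotZl, dotZr) (dotC v u) => h.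
rewrite -subr_ge0 -(pmulr_rge0 _ vv0); apply: le_trans h _.
by rewrite le_eqVlt; apply/orP; left; apply/eqP; ring.
Qed.

(** * Derivatives along lines and the quadratic Taylor bound *)

Lemma derive_dot_grad (R : realType) m (f : 'rV[R]_m.+1 -> R) (x v : 'rV[R]_m.+1) :
  differentiable f x -> 'D_v f x = dot (grad f x) v.
Proof.
move=> df; rewrite deriveE // {1}(row_sum_delta v) linear_sum.
by apply: eq_bigr => i _; rewrite linearZ /= mxE deriveE // mulrC.
Qed.

Lemma is_derive_line (R : realType) m (f : 'rV[R]_m.+1 -> R)
    (x v : 'rV[R]_m.+1) (t : R) :
  differentiable f (x + t *: v) ->
  is_derive t (1 : R) (fun s : R => f (x + s *: v)) (dot (grad f (x + t *: v)) v).
Proof.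
move=> df; have [D E] := (diff_derivable (v := v) df, derive_dot_grad v df).
(* The difference quotient of the restriction to the line is that of [f] in direction [v], so no
   chain rule is involved. *)
have quotE : (fun h : R => h^-1 *:
      (((fun s : R => f (x + s *: v)) \o shift t) (h *: 1) - f (x + t *: v)))
    = (fun h : R => h^-1 *: ((f \o shift (x + t *: v)) (h *: v) - f (x + t *: v))).
  apply/funext => h /=; congr (_ *: (f _ - _)).
  by rewrite scalerDl addrCA [h *: 1]mulr1 addrA.
by split; [rewrite /derivable quotE | rewrite /derive quotE -E].
Qed.

(** The mean value theorem is applied to [phi t - t * dphi 0 - K / 2 * t ^+ 2], whose derivative is
    nonpositive on the open interval. *)
Lemma le_taylor1 (R : realType) (phi dphi : R -> R) (K : R) :
  (forall t, is_derive t (1 : R) phi (dphi t)) ->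
  (forall t, 0 < t < 1 -> dphi t - dphi 0 <= K * t) ->
  phi 1 - phi 0 - dphi 0 <= K / 2.
Proof.
move=> dphiE dphi_le.
pose h t := phi t - t * dphi 0 - (K / 2) * (t * t).
have dh (t : R) : is_derive t 1 h (dphi t - dphi 0 - K * t).
  have := dphiE t => dt; rewrite /h.
  apply: is_derive_eq; rewrite /GRing.scale /=; lra.
have [|c c01] := @MVT R h (fun t => dphi t - dphi 0 - K * t) 0 1 ltr01 (fun t _ => dh t).
  apply: continuous_subspaceT => t.
  by apply/differentiable_continuous/derivable1_diffP; case: (dh t).
have := dphi_le c; move: c01; rewrite in_itv /= => c01 /(_ c01); rewrite /h; lra.
Qed.

(** By Cauchy-Schwarz and the Lipschitz gradient, the slope along [v] varies by at most
    [L * enorm v ^+ 2 * t]; [le_taylor1] for [phi] and [- phi] gives the two sides. The upper side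
    is the descent lemma. *)
Lemma L_smooth_taylor (R : realType) m (f : 'rV[R]_m.+1 -> R) L (x v : 'rV[R]_m.+1) :
  L_smooth L f ->
  `|f (x + v) - f x - dot (grad f x) v| <= L / 2 * enorm v ^+ 2.
Proof.
move=> [df lip].
pose phi (t : R) := f (x + t *: v).
pose dphi (t : R) := dot (grad f (x + t *: v)) v.
have dphiE t : is_derive t (1 : R) phi (dphi t) by apply: is_derive_line.
have dphi_le t : 0 < t < 1 -> `|dphi t - dphi 0| <= (L * enorm v ^+ 2) * t.
  move=> /andP[t0 _]; rewrite /dphi scale0r addr0 -dotNl -dotDl.
  apply: le_trans (cauchy_schwarz _ _) _.
  apply: le_trans (ler_wpM2r (enorm_ge0 v) (lip _ _)) _.
  rewrite addrC addKr enormZ gtr0_norm // le_eqVlt; apply/orP; left; apply/eqP; ring.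
have := @le_taylor1 R phi dphi (L * enorm v ^+ 2) dphiE.
have := @le_taylor1 R (- phi) (fun t => - dphi t) (L * enorm v ^+ 2).
rewrite /phi /dphi !fctE !scale0r !addr0 !scale1r => lo up.
rewrite ler_norml; apply/andP; split.
  suff : - f (x + v) - - f x - - dot (grad f x) v <= L * enorm v ^+ 2 / 2 by lra.
  by apply: lo => t /dphi_le; rewrite /dphi scale0r addr0 ler_norml; lra.
suff : f (x + v) - f x - dot (grad f x) v <= L * enorm v ^+ 2 / 2 by lra.
by apply: up => t /dphi_le; rewrite /dphi scale0r addr0 ler_norml; lra.
Qed.

(* Replaces the passage to the limit [t -> 0+] in the convexity inequality. *)
Lemma le_of_affine_le (R : realType) (a b c : R) :
  (forall t, 0 < t <= 1 -> a <= b + c * t) -> a <= b.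
Proof.
move=> h; apply/ler_addgt0Pr => eps eps0.
pose t := Num.min 1 (eps / (`|c| + 1)).
have c1 : 0 < `|c| + 1 by rewrite ltr_pwDr.
have t0 : 0 < t by rewrite lt_min ltr01 divr_gt0.
have t1 : t <= 1 by rewrite ge_min lexx.
have te : t * (`|c| + 1) <= eps by rewrite -ler_pdivlMr // ge_min lexx orbT.
have := h t; rewrite t0 t1 => /(_ isT) le_a; apply: le_trans le_a _.
by rewrite lerD2l; have := ler_norm c; nra.
Qed.

(** * Inequalities from strong convexity and smoothness *)

Lemma strongly_convex_ge (R : realType) m (f : 'rV[R]_m.+1 -> R) mu L
    (x v : 'rV[R]_m.+1) :
  strongly_convex mu f -> L_smooth L f ->
  f x + dot (grad f x) v + mu / 2 * enorm v ^+ 2 <= f (x + v).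
Proof.
move=> [mu0 sc] Lf.
(* After division by [t], the error consists of [L / 2] from the Taylor remainder and [mu / 2] from
   the factor [1 - t] in strong convexity. *)
apply: (@le_of_affine_le _ _ _ ((L + mu) / 2 * enorm v ^+ 2)) => t /andP[t0 t1].
have := sc (x + v) x t (ltW t0) t1.
have -> : t *: (x + v) + (1 - t) *: x = x + t *: v.
  by rewrite scalerDr scalerBl scale1r addrC addrA addrNK.
rewrite (addrC x v) addrK => up.
have := L_smooth_taylor x (t *: v) Lf; rewrite ler_norml => /andP[lo _].
move: lo; rewrite dotZr enormZ gtr0_norm // exprMn => lo.
rewrite -(ler_pM2l t0); nra.
Qed.

(** On the segment from [xstar] to [x], minimality bounds the convexity inequality from below;
    dividing by [t] leaves an error linear in [t]. *)
Lemma strongly_convex_growth (R : realType) m (f : 'rV[R]_m -> R) mu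
    (xstar x : 'rV[R]_m) :
  strongly_convex mu f -> (forall y, f xstar <= f y) ->
  mu / 2 * enorm (x - xstar) ^+ 2 <= f x - f xstar.
Proof.
move=> [mu0 sc] xmin.
apply: (@le_of_affine_le _ _ _ (mu / 2 * enorm (x - xstar) ^+ 2)) => t /andP[t0 t1].
have := sc x xstar t (ltW t0) t1; have := xmin (t *: x + (1 - t) *: xstar) => lo up.
rewrite -(ler_pM2l t0); nra.
Qed.

(** This minimizes the quadratic lower bound over the displacement [w = y - x], by completing the
    square in [grad f x + mu *: w]. *)
Lemma polyak_lojasiewicz (R : realType) m (f : 'rV[R]_m.+1 -> R) mu L
    (x y : 'rV[R]_m.+1) :
  strongly_convex mu f -> L_smooth L f ->
  2 * mu * (f x - f y) <= enorm (grad f x) ^+ 2.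
Proof.
move=> sc Lf; have mu0 := proj1 sc.
have := ler_wpM2l (ltW mu0) (strongly_convex_ge x (y - x) sc Lf).
rewrite (addrCA x y) subrr addr0.
have := dot_ge0 (grad f x + mu *: (y - x)); move: (y - x) => w.
rewrite dotDl !dotDr !dotZl !dotZr (dotC w (grad f x)) -!sqr_enorm; lra.
Qed.

(** The quadratic lower and upper bounds at [0] are compared along one basis vector. This is also
    the source of [0 < L]. *)
Lemma strongly_convex_mu_le (R : realType) m (f : 'rV[R]_m.+1 -> R) mu L :
  strongly_convex mu f -> L_smooth L f -> mu <= L.
Proof.
move=> sc Lf; pose v : 'rV[R]_m.+1 := delta_mx 0 0.
have := strongly_convex_ge 0 v sc Lf.
have := L_smooth_taylor 0 v Lf; rewrite ler_norml => /andP[_ up] lo.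
have v0 : 0 < enorm v ^+ 2.
  rewrite exprn_gt0 // lt_neqAle eq_sym enorm_eq0 enorm_ge0 andbT.
  by apply/eqP => /rowP/(_ 0)/eqP; rewrite !mxE !eqxx oner_eq0.
rewrite -(ler_pM2r v0); lra.
Qed.

(** A gradient step of length [L^-1] lowers [f] by at least [enorm (grad f x) ^+ 2 / (2 * L)], yet
    cannot go below [f xstar]. *)
Lemma sqr_grad_le (R : realType) m (f : 'rV[R]_m.+1 -> R) L (xstar x : 'rV[R]_m.+1) :
  0 < L -> L_smooth L f -> (forall y, f xstar <= f y) ->
  enorm (grad f x) ^+ 2 <= 2 * L * (f x - f xstar).
Proof.
move=> L0 Lf xmin; have lo := xmin (x + (- L^-1) *: grad f x).
have := L_smooth_taylor x ((- L^-1) *: grad f x) Lf; rewrite ler_norml => /andP[_].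
rewrite dotZr enormZ exprMn normrN gtr0_norm ?invr_gt0 // -sqr_enorm.
set G := enorm _ ^+ 2 => up.
have -> : G = 2 * L * (L^-1 * G - L / 2 * (L^-1 ^+ 2 * G)) by field; rewrite gt_eqF.
by rewrite ler_pM2l ?mulr_gt0 //; lra.
Qed.

(** * The YAND direction and the Armijo step *)

Lemma yand_direction_slope (R : realType) n (f : 'rV[R]_n.+1 -> R)
    (x : 'rV[R]_n.+1) (e : 'I_n -> 'rV[R]_n.+1) (tau : 'rV[R]_n) (d : 'rV[R]_n.+1) :
  grad f x != 0 -> normal_aligned_frame f x e -> yand_direction f x e tau d ->
  dot (grad f x) d = - enorm (grad f x).
Proof.
move=> g0 [_ ge] [_ ->]; rewrite dotDr dotNr dot_sumr big1 => [|i _].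
  by rewrite add0r dotZr -sqr_enorm expr2 mulKf ?enorm_eq0.
by rewrite dotZr ge mulr0.
Qed.

(** Pythagoras: the entries of [tau] are coordinates in an orthonormal family orthogonal to the unit
    gradient. *)
Lemma sqr_enorm_yand_direction (R : realType) n (f : 'rV[R]_n.+1 -> R)
    (x : 'rV[R]_n.+1) (e : 'I_n -> 'rV[R]_n.+1) (tau : 'rV[R]_n) (d : 'rV[R]_n.+1) :
  grad f x != 0 -> normal_aligned_frame f x e -> yand_direction f x e tau d ->
  enorm d ^+ 2 = 1 + enorm tau ^+ 2.
Proof.
move=> g0 [ee ge] [_ ->].
have orth : dot (\sum_(i < n) tau 0 i *: e i) (unit_grad f x) = 0.
  by rewrite dotC dotZl dot_sumr big1 ?mulr0 // => i _; rewrite dotZr ge mulr0.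
have tauE : dot (\sum_(i < n) tau 0 i *: e i) (\sum_(i < n) tau 0 i *: e i) = dot tau tau.
  rewrite dot_suml; apply: eq_bigr => i _; rewrite dotZl dot_sumr; congr (_ * _).
  rewrite (bigD1 i) //= dotZr ee eqxx mulr1 big1 ?addr0 // => j ji.
  by rewrite dotZr ee eq_sym (negPf ji) mulr0.
have unitE : dot (unit_grad f x) (unit_grad f x) = 1.
  by rewrite dotZl dotZr -sqr_enorm; field; rewrite enorm_eq0.
rewrite sqr_enorm dotDl !dotDr !dotNl !dotNr tauE unitE orth.
rewrite (dotC (unit_grad f x) (\sum_(i < n) _)) orth -sqr_enorm; ring.
Qed.

Lemma armijo_ok_small (R : realType) n (f : 'rV[R]_n.+1 -> R) L sigma D a
    (x d : 'rV[R]_n.+1) :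
  0 < L -> L_smooth L f -> 0 < D -> enorm d ^+ 2 <= D -> 0 <= a ->
  dot (grad f x) d = - enorm (grad f x) ->
  a <= 2 * ((1 - sigma) * enorm (grad f x) / (L * D)) ->
  armijo_ok f sigma x d a.
Proof.
move=> L0 Lf D0 dD a0 slope; rewrite mulrA ler_pdivlMr ?mulr_gt0 // => aD.
have := L_smooth_taylor x (a *: d) Lf; rewrite ler_norml => /andP[_].
rewrite dotZr enormZ exprMn ger0_norm // /armijo_ok slope.
(* Half of this says that the quadratic term of the descent lemma fits into the slack
   [(1 - sigma) * a * enorm (grad f x)] of the Armijo test. *)
have : a * (L * (a * enorm d ^+ 2)) <= a * (2 * ((1 - sigma) * enorm (grad f x))).
  apply: ler_wpM2l => //; apply: le_trans aD; rewrite mulrCA.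
  by rewrite ler_wpM2l // ler_pM2l.
rewrite expr2; lra.
Qed.

(* If backtracking occurred, the previous trial step was rejected, hence longer
   than twice the threshold, and it was shrunk by [beta >= 1/2]. *)
Lemma armijo_backtracking_ge (R : realType) n (f : 'rV[R]_n.+1 -> R)
    L sigma beta alpha0 alpha D (x d : 'rV[R]_n.+1) :
  0 < L -> L_smooth L f -> 0 < D -> enorm d ^+ 2 <= D ->
  dot (grad f x) d = - enorm (grad f x) -> 1 / 2 <= beta -> 0 < alpha0 ->
  armijo_backtracking f sigma beta alpha0 x d alpha ->
  alpha = alpha0 \/ (1 - sigma) * enorm (grad f x) / (L * D) <= alpha.
Proof.
move=> L0 Lf D0 dD slope beta_ge alpha0_gt0 [[|m] [-> _ rej]].
  by left; rewrite expr0 mul1r.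
right; have a0 : 0 < beta ^+ m * alpha0 by rewrite mulr_gt0 // exprn_gt0 //; lra.
have := rej m (ltnSn m); apply: contraR; rewrite -ltNge exprS -mulrA => lt_a.
apply: (armijo_ok_small L0 Lf D0 dD (ltW a0) slope); nra.
Qed.

(** The decrease is at least [sigma * c] times the squared gradient norm. The constant [c] is left
    free: [(1 - sigma) / (L * D)] yields [rho], a smaller value the contraction for arbitrary
    [alpha0]. *)
Lemma armijo_contraction (R : realType) n (f : 'rV[R]_n.+1 -> R)
    mu L sigma alpha c (x y d : 'rV[R]_n.+1) :
  strongly_convex mu f -> L_smooth L f -> 0 < sigma -> 0 <= c ->
  dot (grad f x) d = - enorm (grad f x) ->
  armijo_ok f sigma x d alpha -> c * enorm (grad f x) <= alpha ->
  f (x + alpha *: d) - f y <= (1 - 2 * sigma * c * mu) * (f x - f y).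
Proof.
move=> sc Lf s0 c0 slope; rewrite /armijo_ok slope => ok cle.
have PL := polyak_lojasiewicz x y sc Lf.
have s1 : sigma * enorm (grad f x) * (c * enorm (grad f x))
    <= sigma * enorm (grad f x) * alpha.
  by apply: ler_wpM2l => //; rewrite mulr_ge0 ?enorm_ge0 // ltW.
have := ler_wpM2l (mulr_ge0 (ltW s0) c0) PL; rewrite expr2; lra.
Qed.

(** * Q- and R-linear convergence of real sequences *)

Lemma Q_linear_contraction (R : realType) (err : nat -> R) (r : R) :
  0 < r < 1 -> (forall k, 0 <= err k) -> (forall k, err k.+1 <= r * err k) ->
  Q_linear err.
Proof.
move=> /andP[r0 r1] err0 errS; split; last by exists r; split=> //; near=> k.
have geo k : err k <= geometric (err 0%N) r k.
  elim: k => [|k IH]; first by rewrite /geometric /= expr0 mulr1.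
  by apply: le_trans (errS k) _; rewrite /geometric /= exprS mulrCA ler_pM2l.
apply: (@squeeze_cvgr _ _ _ _ (fun=> 0) (geometric (err 0%N) r)).
- by near=> k; rewrite err0 geo.
- exact: cvg_cst.
- by apply: cvg_geometric; rewrite ger0_norm // ltW.
Unshelve. all: by end_near. Qed.

(** The estimates concern squared norms, so the dominating sequence is the square root of
    [a * gap k], contracting with ratio [Num.sqrt r]. *)
Lemma R_linear_sqrt (R : realType) (err gap : nat -> R) (a r : R) :
  0 < r < 1 -> 0 <= a -> (forall k, 0 <= gap k) ->
  (forall k, gap k.+1 <= r * gap k) ->
  (forall k, 0 <= err k) -> (forall k, err k ^+ 2 <= a * gap k) -> R_linear err.
Proof.
move=> /andP[r0 r1] a0 gap0 gapS err0 err_le.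
exists (fun k => Num.sqrt (a * gap k)); split=> [k||k]; first exact: sqrtr_ge0.
  apply: (@Q_linear_contraction _ _ (Num.sqrt r)) => [|k|k].
  - by rewrite sqrtr_gt0 r0 -sqrtr1 ltr_sqrt.
  - exact: sqrtr_ge0.
  rewrite -sqrtrM ?(ltW r0) //; apply: ler_wsqrtr.
  by rewrite mulrCA ler_wpM2l.
by rewrite -[err k]ger0_norm // -sqrtr_sqr ler_wsqrtr.
Qed.

(** The value [rho = 1 / 2] is attained exactly when [T = 0], [sigma = 1 / 2] and [mu = L], hence
    the side condition on the strict bound. *)
Theorem theorem7p6 (R : realType) (n : nat) (f : 'rV[R]_n.+1 -> R)
    (mu L sigma beta alpha0 T : R) (xstar : 'rV[R]_n.+1)
    (x : nat -> 'rV[R]_n.+1) (e : nat -> 'I_n -> 'rV[R]_n.+1)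
    (tau : nat -> 'rV[R]_n) (d : nat -> 'rV[R]_n.+1) (alpha : nat -> R)
    (f_C3 : class_C 3 f)
    (f_sc : strongly_convex mu f)
    (f_smooth : L_smooth L f)
    (xstar_min : forall y, f xstar <= f y)
    (sigma_gt0 : 0 < sigma) (sigma_lt1 : sigma < 1)
    (beta_ge : 1 / 2 <= beta) (beta_lt1 : beta < 1)
    (alpha0_gt0 : 0 < alpha0)
    (run : yand_armijo_run f sigma beta alpha0 x e tau d alpha)
    (tau_bound : T_bounded f x tau T) :
  let rho := rho_Armijo mu L sigma T in
  let gap (k : nat) := f (x k) - f xstar in
  let adequate (k : nat) := trial_step_adequate f L sigma T alpha0 (x k) in
  [/\ (* (i) *)
      [/\ 0 < rho <= 1 / 2,
          [|| T != 0, sigma != 1 / 2 | mu != L] -> rho < 1 / 2,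
          forall k, generated f x k.+1 -> adequate k ->
            gap k.+1 <= (1 - rho) * gap k,
          forall k, generated f x k -> (forall j, (j < k)%N -> adequate j) ->
            gap k <= (1 - rho) ^+ k * gap 0%N
        & (forall k, generated f x k) -> Q_linear (fun k => `|gap k|)],
      (* (ii) *)
      [/\ forall k, generated f x k ->
            enorm (x k - xstar) ^+ 2 <= 2 / mu * gap k,
          forall k, generated f x k -> (forall j, (j < k)%N -> adequate j) ->
            2 / mu * gap k <= 2 / mu * gap 0%N * (1 - rho) ^+ k
        & (forall k, generated f x k) -> R_linear (fun k => enorm (x k - xstar))]
    & (* (iii) *)
      [/\ forall k, generated f x k ->
            enorm (grad f (x k)) ^+ 2 <= 2 * L * gap k,
          forall k, generated f x k -> (forall j, (j < k)%N -> adequate j) ->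
            2 * L * gap k <= 2 * L * gap 0%N * (1 - rho) ^+ k
        & (forall k, generated f x k) -> R_linear (fun k => enorm (grad f (x k)))]].
Proof.
move=> rho gap adequate; have mu0 := proj1 f_sc.
have muL : mu <= L := strongly_convex_mu_le f_sc f_smooth.
have L0 : 0 < L := lt_le_trans mu0 muL.
pose D := 1 + T ^+ 2; have D1 : 1 <= D by rewrite lerDl sqr_ge0.
have D0 : 0 < D := lt_le_trans ltr01 D1.
have rhoE : rho * (D * L) = 2 * (sigma * (1 - sigma)) * mu.
  by rewrite /rho /rho_Armijo -/D; field; rewrite !gt_eqF.
have DL0 : 0 < D * L by rewrite mulr_gt0.
have ss_gt0 : 0 < sigma * (1 - sigma) by rewrite mulr_gt0 // subr_gt0.
have ss_le : sigma * (1 - sigma) <= 1 / 4.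
  by have := sqr_ge0 (sigma - 1 / 2); rewrite expr2; lra.
have LDL : L <= D * L by rewrite ler_peMl // ltW.
have rho_gt0 : 0 < rho by rewrite -(pmulr_lgt0 _ DL0) rhoE pmulr_lgt0 // pmulr_rgt0.
have ss_mu : sigma * (1 - sigma) * mu <= mu / 4.
  by have := ler_wpM2r (ltW mu0) ss_le; lra.
have rho_le : rho <= 1 / 2 by rewrite -(ler_pM2r DL0) rhoE; lra.
have rho_lt : [|| T != 0, sigma != 1 / 2 | mu != L] -> rho < 1 / 2.
  (* Each alternative makes strict one of [L <= D * L], [ss_mu] and [mu <= L]. *)
  move=> neq; rewrite -(ltr_pM2r DL0) rhoE; case/or3P: neq => neq.
  - have : 0 < T ^+ 2 * L by rewrite mulr_gt0 // lt_neqAle eq_sym sqrf_eq0 neq sqr_ge0.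
    by rewrite /D; lra.
  - have : 0 < (sigma - 1 / 2) ^+ 2 * mu.
      by rewrite mulr_gt0 // lt_neqAle eq_sym sqrf_eq0 subr_eq0 neq sqr_ge0.
    by rewrite expr2; lra.
  have : mu < L by rewrite lt_neqAle neq.
  lra.
have gap0 k : 0 <= gap k by rewrite subr_ge0.
have grad_le k : enorm (grad f (x k)) ^+ 2 <= 2 * L * gap k.
  exact: sqr_grad_le.
have growth k : enorm (x k - xstar) ^+ 2 <= 2 / mu * gap k.
  rewrite mulrAC ler_pdivlMr // mulrC.
  by have := strongly_convex_growth (x k) f_sc xstar_min; rewrite /gap; lra.
(* The index [k.+1] puts the gradient at [x k] itself among the nonzero ones: step [k] is really
   performed. *)
have step k : generated f x k.+1 ->
    [/\ dot (grad f (x k)) (d k) = - enorm (grad f (x k)),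
        armijo_ok f sigma (x k) (d k) (alpha k),
        x k.+1 = x k + alpha k *: d k
      & alpha k = alpha0 \/
        (1 - sigma) / (L * D) * enorm (grad f (x k)) <= alpha k].
  move=> gen; have [fr di ar xS] := run _ gen; have g0 := gen k (ltnSn k).
  have slope := yand_direction_slope g0 fr di.
  have dD : enorm (d k) ^+ 2 <= D.
    rewrite (sqr_enorm_yand_direction g0 fr di) lerD2l.
    have tauT := tau_bound _ gen; have tau0 := enorm_ge0 (tau k).
    by rewrite ler_sqr ?nnegrE // (le_trans tau0).
  have := armijo_backtracking_ge L0 f_smooth D0 dD slope beta_ge alpha0_gt0 ar.
  by rewrite mulrAC; split=> //; have [m [-> ]] := ar.
have rho_eq : rho = 2 * sigma * ((1 - sigma) / (L * D)) * mu.
  by rewrite /rho /rho_Armijo -/D; field; rewrite !gt_eqF.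
have c0 : 0 <= (1 - sigma) / (L * D).
  by rewrite divr_ge0 ?mulr_ge0 ?subr_ge0 // ltW.
have gapS k : generated f x k.+1 -> adequate k -> gap k.+1 <= (1 - rho) * gap k.
  move=> gen ad; have [slope ok xS al] := step k gen.
  rewrite /gap xS rho_eq; apply: (armijo_contraction _ f_sc f_smooth) => //.
  (* If the first trial is accepted, [adequate k] is precisely the required lower bound on the
     step. *)
  by case: al => // ->; move: ad; rewrite /adequate /trial_step_adequate mulrAC.
have gapn k : generated f x k -> (forall j, (j < k)%N -> adequate j) ->
    gap k <= (1 - rho) ^+ k * gap 0%N.
  elim: k => [|k IH] gen ad; first by rewrite mul1r.
  apply: le_trans (gapS k gen (ad k (ltnSn k))) _.
  rewrite exprS -mulrA ler_wpM2l ?subr_ge0; [|lra|].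
    by [].
  by apply: IH => j jk; [apply: gen | apply: ad]; rewrite ltnS ltnW.
have [r r01 gapSr] : exists2 r, 0 < r < 1 &
    (forall k, generated f x k) -> forall k, gap k.+1 <= r * gap k.
  (* [G] will bound all gradient norms, since the gaps decrease; the [+ 1] keeps it positive when
     the initial gap is zero. *)
  pose G := Num.sqrt (2 * L * gap 0%N) + 1.
  have G0 : 0 < G by rewrite ltr_wpDl ?sqrtr_ge0.
  (* The first entry serves the steps equal to [alpha0], the second those shortened by
     backtracking. *)
  pose c := Num.min (alpha0 / G) ((1 - sigma) / (L * D)).
  have cgt0 : 0 < c by rewrite lt_min !divr_gt0 ?mulr_gt0 ?subr_gt0.
  (* With [rho <= 1 / 2], this keeps the new contraction factor positive. *)
  have c_le : 2 * sigma * c * mu <= rho.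
    by rewrite rho_eq ler_pM2r // ler_pM2l ?mulr_gt0 // ge_min lexx orbT.
  exists (1 - 2 * sigma * c * mu).
    have : 0 < 2 * sigma * c * mu by rewrite !mulr_gt0.
    lra.
  move=> gen.
  have gap_dec k : gap k.+1 <= gap k.
    have [slope ok xS _] := step k (gen _).
    have al0 : 0 <= alpha k.
      have [_ _ [m [-> _ _]] _] := run _ (gen k.+1).
      by rewrite mulr_ge0 ?exprn_ge0 ?ltW //; lra.
    move: ok; rewrite /armijo_ok slope -xS => ok.
    have := mulr_ge0 (mulr_ge0 (ltW sigma_gt0) al0) (enorm_ge0 (grad f (x k))).
    by rewrite /gap; lra.
  have gap_le0 k : gap k <= gap 0%N.
    by elim: k => // k IH; apply: le_trans (gap_dec k) IH.
  have gradG k : enorm (grad f (x k)) <= G.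
    apply: (@le_trans _ _ (Num.sqrt (2 * L * gap 0%N))); last by rewrite lerDl.
    rewrite -[enorm _]ger0_norm ?enorm_ge0 // -sqrtr_sqr ler_wsqrtr //.
    by apply: le_trans (grad_le k) _; rewrite ler_pM2l ?mulr_gt0.
  move=> k; have [slope ok xS al] := step k (gen _).
  rewrite /gap xS; apply: (armijo_contraction _ f_sc f_smooth) => //; first exact: ltW.
  case: al => [->|]; last first.
    by apply: le_trans; rewrite ler_wpM2r ?enorm_ge0 // ge_min lexx orbT.
  apply: (@le_trans _ _ (alpha0 / G * G)); last by rewrite divfK // gt_eqF.
  by rewrite ler_pM ?enorm_ge0 ?(ltW cgt0) // ge_min lexx.
split; split=> //.
- by rewrite rho_gt0.
- move=> gen; apply: (Q_linear_contraction r01) => k //.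
  by rewrite !ger0_norm // gapSr.
- move=> k gen ad; rewrite -(mulrA _ (gap 0%N)) (mulrC (gap 0%N)).
  by rewrite ler_pM2l ?divr_gt0 // gapn.
- move=> gen; apply: (R_linear_sqrt r01 _ gap0 (gapSr gen) _ growth) => [|k].
    by rewrite divr_ge0 // ltW.
  exact: enorm_ge0.
- move=> k gen ad; rewrite -(mulrA _ (gap 0%N)) (mulrC (gap 0%N)).
  by rewrite ler_pM2l ?mulr_gt0 // gapn.
- move=> gen; apply: (R_linear_sqrt r01 _ gap0 (gapSr gen) _ grad_le) => [|k].
    by rewrite mulr_ge0 // ltW.
  exact: enorm_ge0.
Qed.
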